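(* Let $P$ be the standard triadic Cantor distribution on $\mathbb R$ and let $\beta=\frac{\log 3}{\log 5}$. Then the $\beta$-dimensional quantization coefficient for $P$ does not exist; that is, the limit $\lim_{n\to\infty}n^{2/\beta}V_n(P)$ does not exist.
   Context: For $j=1,2,3$ let $S_j:\mathbb R\to\mathbb R$, $S_j(x)=\frac15x+\frac25(j-1)$. The standard triadic Cantor distribution $P$ is the unique Borel probability measure on $\mathbb R$ with $P=\frac13\sum_{j=1}^3P\circ S_j^{-1}$; its support is the Cantor set $C=S_1(C)\cup S_2(C)\cup S_3(C)$, whose Hausdorff dimension is $\beta=\frac{\log 3}{\log 5}$. For a finite nonempty set $\alpha\subset\mathbb R$ the distortion error is $V(P;\alpha)=\int\min_{a\in\alpha}(x-a)^2\,dP(x)$. The $n$th quantization error is $V_n=V_n(P)=\inf\{V(P;\alpha):\alpha\subset\mathbb R,\ 1\leq\mathrm{card}(\alpha)\leq n\}$. For $s\in(0,\infty)$, the $s$-dimensional quantization coefficient for $P$ is $\lim_{n\to\infty}n^{2/s}V_n(P)$, if it exists. *)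

(* Defs.v *)
From HB Require Import structures.
From mathcomp Require Import all_boot all_order all_algebra.
From mathcomp Require Import finmap.
From mathcomp Require Import all_classical all_reals all_analysis.
Set Implicit Arguments.
Unset Strict Implicit.
Unset Printing Implicit Defensive.

Import Order.TTheory GRing.Theory Num.Theory.
Import numFieldTopology.Exports.

Local Open Scope classical_set_scope.
Local Open Scope ring_scope.

Definition triadicS (R : realType) (j : nat) (x : R) : R :=
  5^-1 * x + (2 / 5) * (j%:R - 1).

(* The equation P = (1/3) \sum_j P o S_j^-1 on Borel sets. It has exactly one
   solution among Borel probability measures. *)
Definition triadic_cantor (R : realType)
    (P : probability (measurableTypeR R) R) : Prop :=
  forall A : set (measurableTypeR R), measurable A ->
    P A = ((3^-1)%:E * \sum_(1 <= j < 4) P (triadicS j @^-1` A))%E.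

Section quantization.
Variables (R : realType) (P : probability (measurableTypeR R) R).

Definition distortion (alpha : {fset R}) : \bar R :=
  (\int[P]_x \big[mine/+oo]_(a <- alpha) ((x - a) ^+ 2)%:E)%E.

Definition quantization_error (n : nat) : \bar R :=
  ereal_inf [set distortion alpha | alpha in
    [set alpha : {fset R} | (1 <= #|` alpha|)%N /\ (#|` alpha| <= n)%N]].

Definition quantization_seq (s : R) (n : nat) : \bar R :=
  ((n%:R `^ (2 / s))%:E * quantization_error n)%E.

(* The limit is taken in \bar R, so an infinite limit counts as existing. *)
Definition quantization_coefficient_exists (s : R) : Prop :=
  cvg (quantization_seq s @ \oo).

End quantization.

Definition cantor_dim (R : realType) : R := ln 3 / ln 5.

(* Main.v *)
Require Import Defs.
From HB Require Import structures.
From mathcomp Require Import all_boot all_order all_algebra.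
From mathcomp Require Import finmap.
From mathcomp Require Import all_classical all_reals all_analysis.
From mathcomp Require Import measurable_realfun.
From mathcomp Require Import ring lra zify.

Set Implicit Arguments.
Unset Strict Implicit.
Unset Printing Implicit Defensive.

Import Order.TTheory GRing.Theory Num.Theory.
Import numFieldNormedType.Exports.

Local Open Scope classical_set_scope.
Local Open Scope ring_scope.

(** Lemmas [quantization_error_le] and [quantization_error_ge] bound the
    quantization errors along [n = 3 ^ k] and [n = 4 * 3 ^ k], and the two
    bounds are incompatible with a common limit of [n `^ (2 / beta) * V_n].

    Along [n = 3 ^ k] the midpoints of the [3 ^ k] cells of level [k] (the
    images of [[0, 1]] under the [k]-fold compositions of the maps
    [triadicS j]) have distortion [25 ^- k * Var(P)], and [Var(P) = 1 / 9].
    Since [3 `^ (2 / beta) = 25], a limit is at most [1 / 9].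

    For the other direction, distinct cells of level [k] are at least one cell
    length apart, so the windows obtained by enlarging every cell by half its
    length on both sides are disjoint.  From inside a cell, a point outside the
    window is no better than the closer end of the window.  Rescaled to the
    unit cell, the ends are [-1/2] and [3/2]; being served only by them costs at
    least [1 / 4], and being served by them and one more point costs at least
    [1 / 10].  With [m] points in the window the cost is therefore at least
    [(2 - m) / 10] for every [m], and as this bound is affine in [m], averaging it
    over the [3 ^ k] cells gives
    [V_n >= 25 ^- k * (2 - n / 3 ^ k) / 10].

    For [n] equal to [4 / 3] times a power of [3] this makes
    [n `^ (2 / beta) * V_n] at least
    [(4 / 3) `^ (2 / beta) * (2 / 3) / 10], and [2 / beta >= 2] already yields
    [16 / 135 > 1 / 9].

    The cells are never enumerated: [integral_triadic], the integrated form of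
    the self-similarity equation, peels off one level at a time, and both bounds
    are inductions on [k]. *)

(** * Self-similarity and support *)

Lemma measurable_triadicS (R : realType) j :
  measurable_fun [set: measurableTypeR R] (@triadicS R j : _ -> measurableTypeR R).
Proof. by apply: measurable_funD => //; apply: measurable_funM. Qed.

(** The self-similarity equation says that [P] is a third of the sum of its
    three pushforwards; this is the change of variables for that sum. *)
Lemma integral_triadic (R : realType) (P : probability (measurableTypeR R) R)
    (hP : triadic_cantor P) (g : measurableTypeR R -> \bar R) :
  measurable_fun setT g -> (forall x, 0 <= g x)%E ->
  (\int[P]_x g x =
   (3^-1)%:E * \sum_(1 <= j < 4) \int[P]_x g (triadicS j x))%E.
Proof.
move=> mg g0.
have m j := @measurable_triadicS R j.
have k0 : (0 <= 3^-1 :> R) by [].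
pose mu_ : nat -> {measure set (measurableTypeR R) -> \bar R} := fun j =>
  pushforward P (@triadicS R j.+1 : _ -> measurableTypeR R).
transitivity (\int[mscale (NngNum k0) (msum (mu_ (fun j => m j.+1)) 3)]_x g x)%E.
  apply: eq_measure_integral => A mA _ /=.
  rewrite (hP A mA) /mscale /= /msum; congr (_ * _)%E.
  by rewrite big_add1 big_mkord.
rewrite ge0_integral_mscale //; congr (_ * _)%E.
rewrite ge0_integral_measure_sum // big_add1 big_mkord.
apply: eq_bigr => j _.
by rewrite ge0_integral_pushforward.
Qed.

Lemma measurable_outside (R : realType) (c : R) :
  measurable ([set x | c < `|x - 2^-1|] : set (measurableTypeR R)).
Proof.
rewrite [X in measurable X](_ : _ =
  (fun x : R => `|x - 2^-1|) @^-1` `]c, +oo[%classic); last first.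
  by apply/seteqP; split => x /=; rewrite in_itv /= andbT.
rewrite -[X in measurable X]setTI.
apply: (_ : measurable_fun setT _) => //.
by apply: measurableT_comp => //; apply: measurable_funB.
Qed.

(** Each of the three maps brings a point five times closer to [[0, 1]] or
    better, so the preimages of the set on the left all lie in the set on the
    right. *)
Lemma mass_outside_le (R : realType) (P : probability (measurableTypeR R) R)
    (hP : triadic_cantor P) (e : R) :
  (P [set x | 2^-1 + e < `|x - 2^-1|]%R <=
   P [set x | 2^-1 + 5 * e < `|x - 2^-1|]%R)%E.
Proof.
rewrite hP; last exact: measurable_outside.
set B := (X in (_ <= P X)%E).
have mB : measurable B by exact: measurable_outside.
have sub j : (1 <= j < 4)%N ->
    (P (triadicS j @^-1` [set x : R | (2^-1 + e < `|x - 2^-1|)%R]) <= P B)%E.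
  move=> jlt; apply: le_measure; rewrite ?inE //.
    rewrite -[X in measurable X]setTI.
    by apply: measurable_triadicS => //; exact: measurable_outside.
  move=> x /=; rewrite /B /= /triadicS.
  case: j jlt => [//|[|[|[|//]]]] _; do 2 case: ger0P => ?; lra.
rewrite (@le_trans _ _ ((3^-1)%:E * (P B *+ 3))%E) //.
  rewrite lee_pmul2l // big_nat; apply: (@le_trans _ _ (\sum_(1 <= i < 4) P B)%E).
    by rewrite [leRHS]big_nat; apply: lee_sum.
  by rewrite sumr_const_nat.
have /fineK <- := fin_num_measure P B mB.
rewrite -EFin_natmul -EFinM lee_fin; lra.
Qed.

(** Iterating [mass_outside_le] pushes the set off to infinity without losing
    mass. *)
Lemma mass_outside_eps (R : realType) (P : probability (measurableTypeR R) R)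
    (hP : triadic_cantor P) (e : R) : 0 < e ->
  P [set x | 2^-1 + e < `|x - 2^-1|]%R = 0%E.
Proof.
move=> e0.
pose F n := [set x : measurableTypeR R | 2^-1 + 5 ^+ n * e < `|x - 2^-1|]%R.
have FE n : (P (F 0%N) <= P (F n))%E.
  elim: n => [//|n IH]; apply: (le_trans IH).
  by rewrite /F exprS -mulrA; exact: mass_outside_le.
have F0 : \bigcap_n F n = set0.
  apply/seteqP; split => // x /=.
  move=> /(_ (Num.truncn (`|x - 2^-1| / e)).+1 I); rewrite /F /=.
  apply/negP; rewrite -leNgt.
  set n := Num.truncn _.
  have : `|x - 2^-1| / e < n.+1%:R.
    by apply: truncnS_gt.
  rewrite ltr_pdivrMr // => h.
  have : n.+1%:R * e <= 5 ^+ n.+1 * e.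
    rewrite ler_pM2r // -natrX ler_nat ltnW //; exact: ltn_expl.
  lra.
have mF n : measurable (F n) by exact: measurable_outside.
have cF : (P \o F) x @[x --> \oo] --> P (\bigcap_n F n).
  apply: nonincreasing_cvg_mu => //.
  - by rewrite (le_lt_trans (probability_le1 _ _)) // ltry.
  - by rewrite F0.
  - move=> n m nm; apply/subsetPset => x; rewrite /F /=.
    apply: le_lt_trans; rewrite lerD2l ler_pM2r //.
    by rewrite ler_weXn2l // ler1n.
rewrite F0 measure0 in cF.
have : (P (F 0%N) <= 0)%E.
  by apply: cvge_ge cF; apply: nearW => n; exact: FE.
by rewrite measure_le0 /F expr0 mul1r => /eqP.
Qed.

Lemma support_unit (R : realType) (P : probability (measurableTypeR R) R)
    (hP : triadic_cantor P) : P (~` `[0, 1]%classic) = 0%E.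
Proof.
apply/negligibleP; first by apply: measurableC.
apply: (@negligibleS _ _ _ P
  (\bigcup_n [set x : measurableTypeR R | 2^-1 + n.+1%:R^-1 < `|x - 2^-1|]%R)).
  move=> x /= /negP; rewrite in_itv /= negb_and -!ltNge => h.
  have d0 : 0 < `|x - 2^-1| - 2^-1.
    by case/orP: h => h; case: ger0P => ?; lra.
  exists (Num.truncn (`|x - 2^-1| - 2^-1)^-1) => //=.
  set n := Num.truncn _.
  have : n.+1%:R^-1 < `|x - 2^-1| - 2^-1.
    by rewrite invf_plt ?posrE // truncnS_gt.
  by rewrite ltrBrDl.
apply: negligible_bigcup => n.
apply/negligibleP; first exact: measurable_outside.
by apply: mass_outside_eps.
Qed.

Lemma integral_unit (R : realType) (P : probability (measurableTypeR R) R)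
    (hP : triadic_cantor P) (g : measurableTypeR R -> \bar R) :
  measurable_fun setT g -> (forall x, 0 <= g x)%E ->
  (\int[P]_x g x = \int[P]_(x in `[0%R, 1%R]) g x)%E.
Proof.
move=> mg g0.
rewrite (@ge0_negligible_integral _ _ _ P setT (~` `[0, 1]%classic)) //.
- by rewrite setTD setCK.
- exact: measurableC.
- exact: support_unit.
Qed.

(** * Moments *)

Lemma measurable_quadratic (R : realType) (D : set (measurableTypeR R)) (a b c : R) :
  measurable_fun D (fun x : measurableTypeR R => a * x ^+ 2 + b * x + c).
Proof.
apply: measurable_funD => //; apply: measurable_funD; last exact: measurable_funM.
by apply: measurable_funM => //; exact: measurable_funX.
Qed.

Lemma integrable_quadratic (R : realType) (P : probability (measurableTypeR R) R)
    (a b c : R) :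
  P.-integrable `[0, 1]%classic (EFin \o (fun x : R => a * x ^+ 2 + b * x + c)).
Proof.
apply: measurable_bounded_integrable => //.
- by rewrite (le_lt_trans (probability_le1 _ _)) // ltry.
- exact: measurable_quadratic.
- exists (`|a| + `|b| + `|c|); split => // M ltM x /=.
  rewrite in_itv /= => /andP[x0 x1].
  apply: le_trans (ltW ltM).
  apply: (le_trans (ler_normD _ _)); rewrite lerD2r.
  apply: (le_trans (ler_normD _ _)).
  rewrite (normrM a) (normrM b) (ger0_norm x0) (ger0_norm (sqr_ge0 x)).
  by apply: lerD; apply: ler_piMr => //; exact: exprn_ile1.
Qed.

(** Linearity reduces all quadratics to the first two moments, whose values
    are found afterwards. *)
Lemma integral_quadratic_linear (R : realType) (P : probability (measurableTypeR R) R)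
    (hP : triadic_cantor P) :
  exists m1 m2 : R, forall a b c : R,
  (\int[P]_(x in `[0%R, 1%R]) (a * x ^+ 2 + b * x + c)%:E =
   (a * m2 + b * m1 + c)%:E)%E.
Proof.
have mI : measurable (`[0, 1]%classic : set (measurableTypeR R)) by [].
have int1 : P.-integrable `[0%R, 1%R]%classic (EFin \o (fun x : R => x)).
  have := integrable_quadratic P 0 1 0; congr (P.-integrable _ (EFin \o _)).
  by apply/funext => x; ring.
have int2 : P.-integrable `[0%R, 1%R]%classic (EFin \o (fun x : R => x ^+ 2)).
  have := integrable_quadratic P 1 0 0; congr (P.-integrable _ (EFin \o _)).
  by apply/funext => x; ring.
exists (\int[P]_(x in `[0%R, 1%R]) x)%R, (\int[P]_(x in `[0%R, 1%R]) (x ^+ 2))%R.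
move=> a b c.
have i2 : P.-integrable `[0%R, 1%R]%classic (EFin \o (fun x : R => a * x ^+ 2)).
  have := integrable_quadratic P a 0 0; congr (P.-integrable _ (EFin \o _)).
  by apply/funext => x; ring.
have i1 : P.-integrable `[0%R, 1%R]%classic (EFin \o (fun x : R => b * x)).
  have := integrable_quadratic P 0 b 0; congr (P.-integrable _ (EFin \o _)).
  by apply/funext => x; ring.
have i0 : P.-integrable `[0%R, 1%R]%classic (EFin \o (fun x : R => c)).
  have := integrable_quadratic P 0 0 c; congr (P.-integrable _ (EFin \o _)).
  by apply/funext => x; ring.
have i21 : P.-integrable `[0%R, 1%R]%classic (EFin \o (fun x : R => a * x ^+ 2 + b * x)).
  have := integrable_quadratic P a b 0; congr (P.-integrable _ (EFin \o _)).
  by apply/funext => x; ring.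
have -> : (\int[P]_(x in `[0%R, 1%R]) (a * x ^+ 2 + b * x + c)%:E =
  (\int[P]_(x in `[0%R, 1%R]) (a * x ^+ 2 + b * x + c)%R)%:E)%E.
  by rewrite fineK // integrable_fin_num //; exact: integrable_quadratic.
congr EFin.
rewrite RintegralD // RintegralD // RintegralZl // RintegralZl //; congr (_ + _).
have PI1 : P `[0, 1]%classic = 1%E.
  rewrite -[X in P X]setCK probability_setC; last exact: measurableC.
  by rewrite support_unit // sube0.
by rewrite Rintegral_cst // [X in fine X]PI1 mulr1.
Qed.

(** Expanding the second moment about [d] by self-similarity gives, for each
    [d], one linear equation between the two moments; [d = 0] and [d = 1]
    determine them: mean [1 / 2], second moment [13 / 36], hence variance
    [1 / 9]. *)
Lemma integral_quadratic (R : realType) (P : probability (measurableTypeR R) R)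
    (hP : triadic_cantor P) (a b c : R) :
  (\int[P]_(x in `[0%R, 1%R]) (a * x ^+ 2 + b * x + c)%:E =
   (a * (13 / 36) + b / 2 + c)%:E)%E.
Proof.
have [m1 [m2 m12]] := integral_quadratic_linear hP.
have sq (u v : R) : (\int[P]_x ((u * x + v) ^+ 2)%:E =
    (u ^+ 2 * m2 + (2 * u * v) * m1 + v ^+ 2)%:E)%E.
  have E x : (u * x + v) ^+ 2 = u ^+ 2 * x ^+ 2 + 2 * u * v * x + v ^+ 2 by ring.
  rewrite integral_unit //.
  - by under eq_integral do rewrite E; exact: m12.
  - apply/measurable_EFinP.
    by under eq_fun do rewrite E; exact: measurable_quadratic.
  - by move=> x; rewrite lee_fin sqr_ge0.
have self (d : R) : m2 - 2 * d * m1 + d ^+ 2 =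
    3^-1 * ((25^-1 * m2 - 2 / 5 * d * m1 + d ^+ 2) +
      (25^-1 * m2 + 2 / 5 * (2 / 5 - d) * m1 + (2 / 5 - d) ^+ 2) +
      (25^-1 * m2 + 2 / 5 * (4 / 5 - d) * m1 + (4 / 5 - d) ^+ 2)).
  have := sq 1 (- d).
  rewrite (@integral_triadic _ _ hP (fun x => ((1 * x - d) ^+ 2)%:E)); last first.
  - by move=> x; rewrite lee_fin sqr_ge0.
  - apply/measurable_EFinP.
    have E x : (1 * x - d) ^+ 2 = 1 * x ^+ 2 + - 2 * d * x + d ^+ 2 by ring.
    by under eq_fun do rewrite E; exact: measurable_quadratic.
  have E j x : 1 * triadicS j x - d = 5^-1 * x + ((2 / 5) * (j%:R - 1) - d).
    by rewrite /triadicS; ring.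
  under eq_bigr do under eq_integral do rewrite E.
  rewrite 3?big_nat_recl // big_geq // !sq -!EFinD -EFinM => -[] H.
  lra.
have := self 0; have := self 1 => h1 h0.
have -> : a * (13 / 36) + b / 2 + c = a * m2 + b * m1 + c.
  have -> : m1 = 2^-1 by lra.
  have -> : m2 = 13 / 36 by lra.
  lra.
exact: m12.
Qed.

(** * Cost of the unit cell in terms of the points in its window *)

Lemma le_integral_unit (R : realType) (P : probability (measurableTypeR R) R)
    (hP : triadic_cantor P) (f g : measurableTypeR R -> \bar R) :
  measurable_fun setT f -> measurable_fun setT g ->
  (forall x, 0 <= f x)%E -> (forall x, 0 <= g x)%E ->
  (forall x : R, 0 <= x <= 1 -> (f x <= g x)%E) ->
  (\int[P]_x f x <= \int[P]_x g x)%E.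
Proof.
move=> mf mg f0 g0 fg; rewrite !integral_unit //.
by apply: ge0_le_integral => //; exact: measurable_funTS.
Qed.

Lemma quadratic_le_integral (R : realType) (P : probability (measurableTypeR R) R)
    (hP : triadic_cantor P) (f : measurableTypeR R -> R) (a b c : R) :
  measurable_fun setT f -> (forall x, 0 <= f x) ->
  (forall x : R, 0 <= x <= 1 -> 0 <= a * x ^+ 2 + b * x + c <= f x) ->
  ((a * (13 / 36) + b / 2 + c)%:E <= \int[P]_x (f x)%:E)%E.
Proof.
move=> mf f0 qf; have mEf : measurable_fun setT (EFin \o f) by apply/measurable_EFinP.
rewrite (integral_unit hP mEf) // -(integral_quadratic hP).
apply: ge0_le_integral => //.
- by move=> x /=; rewrite in_itv /= lee_fin => /qf /andP[].
- by apply/measurable_EFinP; exact: measurable_quadratic.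
- exact: measurable_funTS.
- by move=> x /=; rewrite in_itv /= lee_fin => /qf /andP[].
Qed.

(** On the cell starting at [s], [P] has mean [s + 1 / 10] and variance
    [(1 / 9) / 25 = 1 / 225]. *)
Lemma quadratic_le_cell_integral (R : realType)
    (P : probability (measurableTypeR R) R) (hP : triadic_cantor P)
    (f : measurableTypeR R -> R) (j : nat) (a b c : R) :
  let s := 2 / 5 * (j%:R - 1) in
  measurable_fun setT f -> (forall x, 0 <= f x) ->
  (forall y : R, s <= y <= s + 5^-1 -> 0 <= a * y ^+ 2 + b * y + c <= f y) ->
  ((a * ((s + 10^-1) ^+ 2 + 225^-1) + b * (s + 10^-1) + c)%:E <=
   \int[P]_x (f (triadicS j x))%:E)%E.
Proof.
move=> s mf f0 qf.
have -> : a * ((s + 10^-1) ^+ 2 + 225^-1) + b * (s + 10^-1) + c =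
  (a / 25) * (13 / 36) + (2 / 5 * a * s + b / 5) / 2 + (a * s ^+ 2 + b * s + c) by field.
apply: quadratic_le_integral => //.
  by apply: measurableT_comp => //; exact: measurable_triadicS.
move=> x x01; have := qf (triadicS j x).
have -> : a * triadicS j x ^+ 2 + b * triadicS j x + c =
  a / 25 * x ^+ 2 + (2 / 5 * a * s + b / 5) * x + (a * s ^+ 2 + b * s + c).
  by rewrite /triadicS -/s; field.
by apply; rewrite /triadicS -/s; lra.
Qed.

Lemma integral_ge_cells (R : realType) (P : probability (measurableTypeR R) R)
    (hP : triadic_cantor P) (f : measurableTypeR R -> R) (t1 t2 t3 : R) :
  measurable_fun setT f -> (forall x, 0 <= f x) ->
  (t1%:E <= \int[P]_x (f (triadicS 1 x))%:E)%E ->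
  (t2%:E <= \int[P]_x (f (triadicS 2 x))%:E)%E ->
  (t3%:E <= \int[P]_x (f (triadicS 3 x))%:E)%E ->
  ((3^-1 * (t1 + t2 + t3))%:E <= \int[P]_x (f x)%:E)%E.
Proof.
move=> mf f0 h1 h2 h3.
rewrite (@integral_triadic _ _ hP (fun x => (f x)%:E)) //; last first.
  exact/measurable_EFinP.
rewrite EFinM lee_pmul2l // 3?big_nat_recl // big_geq // adde0 -addrA !EFinD.
by do 2?apply: leeD.
Qed.

(** The fence posts [-1/2] and [3/2] stand for all points that serve
    neighbouring cells: on [[0, 1]] they are at least as good as any point
    beyond them, so only the points of [al] between them matter
    ([fenced_sqdist_filter]). *)
Definition fenced_sqdist (R : realType) (al : seq R) (x : R) : R :=
  foldr (fun a m => Num.min ((x - a) ^+ 2) m)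
    (Num.min ((x + 2^-1) ^+ 2) ((x - 3 / 2) ^+ 2)) al.

Lemma le_fenced_sqdist (R : realType) (al : seq R) (x t : R) :
  (t <= fenced_sqdist al x) =
  [&& t <= (x + 2^-1) ^+ 2, t <= (x - 3 / 2) ^+ 2 &
      all (fun a => t <= (x - a) ^+ 2) al].
Proof.
elim: al => [|a al IH] /=; first by rewrite le_min andbT.
by rewrite le_min IH andbCA; congr (_ && _); rewrite andbCA.
Qed.

Lemma fenced_sqdist_ge0 (R : realType) (al : seq R) (x : R) :
  0 <= fenced_sqdist al x.
Proof.
by rewrite le_fenced_sqdist !sqr_ge0 /=; apply/allP => a _; exact: sqr_ge0.
Qed.

Lemma measurable_sqdist (R : realType) (a : R) :
  measurable_fun [set: measurableTypeR R] (fun x : R => (x - a) ^+ 2).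
Proof. by apply: measurable_funX; exact: measurable_funB. Qed.

Lemma measurable_fenced_sqdist (R : realType) (al : seq R) :
  measurable_fun [set: measurableTypeR R] (fenced_sqdist al).
Proof.
elim: al => [|a al IH] /=; apply: measurable_minr => //.
- by under eq_fun do rewrite -[2^-1]opprK; exact: measurable_sqdist.
- exact: measurable_sqdist.
- exact: measurable_sqdist.
Qed.

Definition in_window (R : realType) (a : R) : bool := - 2^-1 < a < 3 / 2.

Lemma fenced_sqdist_filter (R : realType) (al : seq R) (x : R) :
  0 <= x <= 1 ->
  fenced_sqdist [seq a <- al | in_window a] x <= fenced_sqdist al x.
Proof.
move=> /andP[x0 x1]; rewrite le_fenced_sqdist.
have := lexx (fenced_sqdist [seq a <- al | in_window a] x).
set h := (X in X <= _ -> _).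
rewrite le_fenced_sqdist => /and3P[h1 h2 /allP h3]; rewrite h1 h2 /=.
apply/allP => a aal; case: (boolP (in_window a)) => wa.
  by apply: h3; rewrite mem_filter wa.
move: wa; rewrite /in_window negb_and -!leNgt => /orP[ha|ha].
- by apply: (le_trans h1); nra.
- by apply: (le_trans h2); nra.
Qed.

Lemma integral_fenced0 (R : realType) (P : probability (measurableTypeR R) R)
    (hP : triadic_cantor P) :
  ((4^-1)%:E <= \int[P]_x (fenced_sqdist [::] x)%:E)%E.
Proof.
have -> : 4^-1 = 0 * (13 / 36) + 0 / 2 + 4^-1 :> R by field.
apply: quadratic_le_integral => //; first exact: measurable_fenced_sqdist.
- exact: fenced_sqdist_ge0.
- move=> x /andP[x0 x1]; rewrite le_fenced_sqdist /= andbT.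
  by apply/and3P; split; nra.
Qed.

(** On the first cell the fence post [-1/2] competes with [a].  Once [y ^+ 2]
    is subtracted, both squared distances are affine in [y], and the line from
    height [1 / 4] at [0] to the height of [(y - a) ^+ 2] at [1 / 5] lies
    below both. *)
Lemma chord_le (R : realType) (a y : R) :
  2^-1 <= a <= 9 / 10 -> 0 <= y <= 5^-1 ->
  let q := y ^+ 2 + 5 * (a ^+ 2 - 2 / 5 * a - 4^-1) * y + 4^-1 in
  [/\ 0 <= q, q <= (y + 2^-1) ^+ 2, q <= (y - 3 / 2) ^+ 2 & q <= (y - a) ^+ 2].
Proof.
move=> /andP[a0 a1] /andP[y0 y1].
set c := 5 * (a ^+ 2 - 2 / 5 * a - 4^-1) => q.
have c0 : 0 <= (c + 1) * y by apply: mulr_ge0 => //; rewrite /c; nra.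
have c1 : 0 <= (1 - c) * y by apply: mulr_ge0 => //; rewrite /c; nra.
have sq := sqr_ge0 (y - 2^-1).
split; rewrite /q; try nra.
rewrite -subr_ge0 (_ : _ - _ = (a ^+ 2 - 4^-1) * (1 - 5 * y)); last first.
  by rewrite /c; field.
by apply: mulr_ge0; nra.
Qed.

(** The hypotheses place the cell between the midpoints of [a] with the two
    fence posts, so that [a] serves all of it. *)
Lemma served_cell_integral (R : realType)
    (P : probability (measurableTypeR R) R) (hP : triadic_cantor P) (a : R)
    (j : nat) :
  let s := 2 / 5 * (j%:R - 1) in
  in_window a -> (a - 2^-1) / 2 <= s -> s + 5^-1 <= (a + 3 / 2) / 2 ->
  (((s + 10^-1 - a) ^+ 2 + 225^-1)%:E <=
   \int[P]_x (fenced_sqdist [:: a] (triadicS j x))%:E)%E.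
Proof.
move=> s /andP[a0 a1] sl sr.
have -> : (s + 10^-1 - a) ^+ 2 + 225^-1 =
  1 * ((s + 10^-1) ^+ 2 + 225^-1) + (- 2 * a) * (s + 10^-1) + a ^+ 2 by ring.
apply: quadratic_le_cell_integral => //; first exact: measurable_fenced_sqdist.
  exact: fenced_sqdist_ge0.
move=> y; rewrite -/s => /andP[y0 y1].
have -> : 1 * y ^+ 2 + - 2 * a * y + a ^+ 2 = (y - a) ^+ 2 by ring.
rewrite sqr_ge0 le_fenced_sqdist /= lexx /= andbT; apply/andP; split.
- rewrite -subr_ge0 (_ : _ - _ = (a + 2^-1) * (2 * y - a + 2^-1)); last by field.
  by apply: mulr_ge0; lra.
- rewrite -subr_ge0 (_ : _ - _ = (3 / 2 - a) * (a + 3 / 2 - 2 * y)); last by field.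
  by apply: mulr_ge0; lra.
Qed.

(** If [a] is far to one side, the cell at the other end is expensive by
    itself.  Otherwise [a] serves the two cells on its side entirely, and the
    remaining cell is estimated by [chord_le], for [a] on the right half of the
    window directly and on the left half after the reflection [y |-> 1 - y]. *)
Lemma integral_fenced1 (R : realType) (P : probability (measurableTypeR R) R)
    (hP : triadic_cantor P) (a : R) : in_window a ->
  ((10^-1)%:E <= \int[P]_x (fenced_sqdist [:: a] x)%:E)%E.
Proof.
move=> wa; have /andP[a0 a1] := wa.
have mf := measurable_fenced_sqdist [:: a].
have f0 := fenced_sqdist_ge0 [:: a].
have free_cell j :
    (0%:E <= \int[P]_x (fenced_sqdist [:: a] (triadicS j x))%:E)%E.
  by apply: integral_ge0 => x _; rewrite lee_fin.
have [lea|lta] := leP (9 / 10) a.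
  have t1 : (((25 / 100 + 10^-1) + (10^-1 ^+ 2 + 225^-1))%:E <=
      \int[P]_x (fenced_sqdist [:: a] (triadicS 1 x))%:E)%E.
    apply: le_trans (@quadratic_le_cell_integral _ _ hP _ 1 1 1 4^-1 mf f0 _).
      by rewrite lee_fin; lra.
    move=> y; rewrite le_fenced_sqdist /= andbT => /andP[y0 y1].
    by apply/and4P; split; nra.
  apply: le_trans (integral_ge_cells hP mf f0 t1 (free_cell _) (free_cell _)).
  by rewrite lee_fin; lra.
have [lea|lea] := leP a (10^-1).
  have t3 : (((25 / 100 + 10^-1) + (10^-1 ^+ 2 + 225^-1))%:E <=
      \int[P]_x (fenced_sqdist [:: a] (triadicS 3 x))%:E)%E.
    apply: le_trans
      (@quadratic_le_cell_integral _ _ hP _ 3 1 (- 3) (9 / 4) mf f0 _).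
      by rewrite lee_fin; lra.
    move=> y; rewrite le_fenced_sqdist /= andbT => /andP[y0 y1].
    by apply/and4P; split; nra.
  apply: le_trans (integral_ge_cells hP mf f0 (free_cell _) (free_cell _) t3).
  by rewrite lee_fin; lra.
have [half|half] := leP (2^-1) a.
  have t1 := @quadratic_le_cell_integral _ _ hP _ 1
    1 (5 * (a ^+ 2 - 2 / 5 * a - 4^-1)) 4^-1 mf f0.
  have t2 := @served_cell_integral _ _ hP a 2 wa ltac:(lra) ltac:(lra).
  have t3 := @served_cell_integral _ _ hP a 3 wa ltac:(lra) ltac:(lra).
  apply: le_trans (integral_ge_cells hP mf f0 (t1 _) t2 t3).
  - (* [5 / 2 * a ^+ 2 - 3 * a] is minimal at [3 / 5] *)
    by rewrite lee_fin; have := sqr_ge0 (a - 3 / 5); lra.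
  - move=> y; rewrite le_fenced_sqdist /= andbT => /andP[y0 y1].
    have [||p1 p2 p3 p4] := @chord_le _ a y; [lra|lra|].
    by apply/and4P; split; lra.
have t1 := @served_cell_integral _ _ hP a 1 wa ltac:(lra) ltac:(lra).
have t2 := @served_cell_integral _ _ hP a 2 wa ltac:(lra) ltac:(lra).
have t3 := @quadratic_le_cell_integral _ _ hP _ 3
  1 (- 2 - 5 * ((1 - a) ^+ 2 - 2 / 5 * (1 - a) - 4^-1))
  (1 + 4^-1 + 5 * ((1 - a) ^+ 2 - 2 / 5 * (1 - a) - 4^-1)) mf f0.
apply: le_trans (integral_ge_cells hP mf f0 t1 t2 (t3 _)).
- by rewrite lee_fin; have := sqr_ge0 (a - 2 / 5); lra.
- move=> y; rewrite le_fenced_sqdist /= andbT => /andP[y0 y1].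
  have [||p1 p2 p3 p4] := @chord_le _ (1 - a) (1 - y); [lra|lra|].
  by apply/and4P; split; lra.
Qed.

(** The affine bound joins the values [1 / 4 >= 2 / 10] for an empty window,
    [1 / 10] for one point, and [0] for two. *)
Lemma integral_fenced_ge_window (R : realType)
    (P : probability (measurableTypeR R) R) (hP : triadic_cantor P) (al : seq R) :
  ((10^-1 * (2 - (count (@in_window R) al)%:R))%:E <=
   \int[P]_x (fenced_sqdist al x)%:E)%E.
Proof.
set w := [seq a <- al | in_window a].
have le_w : (\int[P]_x (fenced_sqdist w x)%:E <= \int[P]_x (fenced_sqdist al x)%:E)%E.
  apply: le_integral_unit => //.
  - by apply/measurable_EFinP; exact: measurable_fenced_sqdist.
  - by apply/measurable_EFinP; exact: measurable_fenced_sqdist.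
  - by move=> x; rewrite lee_fin fenced_sqdist_ge0.
  - by move=> x; rewrite lee_fin fenced_sqdist_ge0.
  - by move=> x x01; rewrite lee_fin fenced_sqdist_filter.
apply: le_trans le_w; rewrite -size_filter -/w.
have : all (@in_window R) w by exact: filter_all.
case: w => [|a [|b w]] /=.
- move=> _; apply: le_trans (integral_fenced0 hP); rewrite lee_fin; lra.
- rewrite andbT => wa.
  apply: le_trans (integral_fenced1 hP wa); rewrite lee_fin; lra.
- move=> _; apply: (@le_trans _ _ 0%E).
    have : 2 <= (size w).+2%:R :> R by rewrite ler_nat.
    by rewrite lee_fin; lra.
  by apply: integral_ge0 => x _; rewrite lee_fin (fenced_sqdist_ge0 [:: a, b & w]).
Qed.

(** * Lower bound for the quantization error *)

Definition triadicS_inv (R : realType) (j : nat) (a : R) : R :=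
  5 * a - 2 * (j%:R - 1).

(** The fence posts of the whole interval are at distance at least [1 / 2] from
    each cell, beyond those of the cell, so passing to the cell can only bring
    the posts closer. *)
Lemma fenced_sqdist_triadicS (R : realType) (j : nat) (al : seq R) (x : R) :
  (1 <= j < 4)%N -> 0 <= x <= 1 ->
  25^-1 * fenced_sqdist (map (triadicS_inv j) al) x <=
  fenced_sqdist al (triadicS j x).
Proof.
move=> j14 /andP[x0 x1].
have /andP[S0 S1] : 0 <= triadicS j x <= 1.
  rewrite /triadicS; case: j j14 => [//|[|[|[|//]]]] _; lra.
have := lexx (fenced_sqdist (map (triadicS_inv j) al) x).
rewrite !le_fenced_sqdist => /and3P[h1 h2 /allP h3].
have x1le : (x + 2^-1) ^+ 2 <= 9 / 4 by nra.
have S1ge : 4^-1 <= (triadicS j x + 2^-1) ^+ 2 by nra.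
have S2ge : 4^-1 <= (triadicS j x - 3 / 2) ^+ 2 by nra.
apply/and3P; split; [lra|lra|].
apply/allP => a /(map_f (triadicS_inv j)) /h3.
rewrite (_ : x - _ = 5 * (triadicS j x - a)); last by rewrite /triadicS /triadicS_inv; field.
rewrite exprMn; lra.
Qed.

(** The windows of the three cells are disjoint and lie in the window of
    [[0, 1]]. *)
Lemma count_window_triadicS (R : realType) (al : seq R) :
  (\sum_(1 <= j < 4) count (@in_window R) (map (triadicS_inv j) al) <=
   count (@in_window R) al)%N.
Proof.
rewrite 3?big_nat_recl // big_geq // addn0.
elim: al => [//|a al IH] /=.
rewrite addnACA [(_ + (count _ _ + _))%N]addnCA.
suff : (in_window (triadicS_inv 1 a) + (in_window (triadicS_inv 2 a) +
    in_window (triadicS_inv 3 a)) <= in_window a)%N by lia.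
rewrite /in_window /triadicS_inv.
case: (boolP (- 2^-1 < a < 3 / 2)) => ha;
case: (boolP (_ && _)) => h1; case: (boolP (_ && _)) => h2;
case: (boolP (_ && _)) => h3 //; exfalso; lra.
Qed.

(** The affine bound of [integral_fenced_ge_window] survives averaging over the
    cells because the window counts of the cells add up to at most that of the
    whole. *)
Lemma integral_fenced_ge (R : realType)
    (P : probability (measurableTypeR R) R) (hP : triadic_cantor P)
    (k : nat) (al : seq R) :
  ((25 ^- k * (10^-1 * (2 - (count (@in_window R) al)%:R / 3 ^+ k)))%:E <=
   \int[P]_x (fenced_sqdist al x)%:E)%E.
Proof.
elim: k al => [|k IH] al.
  by rewrite !expr0 invr1 mul1r mulr1; exact: integral_fenced_ge_window.
pose c j := (count (@in_window R) (map (triadicS_inv j) al))%:R : R.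
have cell j : (1 <= j < 4)%N ->
    ((25^-1 * (25 ^- k * (10^-1 * (2 - c j / 3 ^+ k))))%:E <=
     \int[P]_x (fenced_sqdist al (triadicS j x))%:E)%E.
  move=> j14; rewrite EFinM.
  apply: (@le_trans _ _ (25^-1%:E *
      \int[P]_x (fenced_sqdist (map (triadicS_inv j) al) x)%:E)%E).
    by rewrite lee_pmul2l // IH.
  rewrite -ge0_integralZl_EFin //.
  - apply: le_integral_unit => //.
    + apply/measurable_EFinP; apply: measurable_funM => //.
      exact: measurable_fenced_sqdist.
    + apply/measurable_EFinP; apply: measurableT_comp; last exact: measurable_triadicS.
      exact: measurable_fenced_sqdist.
    + by move=> x; rewrite lee_fin mulr_ge0 // fenced_sqdist_ge0.
    + by move=> x; rewrite lee_fin fenced_sqdist_ge0.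
    + by move=> x x01; rewrite lee_fin fenced_sqdist_triadicS.
  - by move=> x _; rewrite lee_fin fenced_sqdist_ge0.
  - by apply/measurable_EFinP; exact: measurable_fenced_sqdist.
apply: le_trans (integral_ge_cells hP (measurable_fenced_sqdist al)
  (fenced_sqdist_ge0 al) (cell 1%N isT) (cell 2%N isT) (cell 3%N isT)).
rewrite lee_fin.
have csum : c 1%N + c 2%N + c 3%N <= (count (@in_window R) al)%:R.
  have := count_window_triadicS al; rewrite 3?big_nat_recl // big_geq // addn0.
  by rewrite -(ler_nat R) !natrD addrA.
rewrite ![_ ^+ k.+1]exprS !invfM.
set t := 25 ^- k; set u := (3 ^+ k)^-1.
have : 0 <= t * u by apply: mulr_ge0; rewrite invr_ge0 exprn_ge0.
move: t u (_%:R) (c 1%N) (c 2%N) (c 3%N) csum => t u n c1 c2 c3 csum tu.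
have : t * u * (c1 + c2 + c3) <= t * u * n by exact: ler_wpM2l.
lra.
Qed.

Lemma le_min_sqdist (R : realType) (al : seq R) (x : R) (t : \bar R) :
  (t <= \big[mine/+oo]_(a <- al) ((x - a) ^+ 2)%:E)%E =
  all (fun a => (t <= ((x - a) ^+ 2)%:E)%E) al.
Proof.
elim: al => [|a al IH]; first by rewrite big_nil leey.
by rewrite big_cons le_min IH.
Qed.

Lemma min_sqdist_ge0 (R : realType) (al : seq R) (x : R) :
  (0 <= \big[mine/+oo]_(a <- al) ((x - a) ^+ 2)%:E)%E.
Proof. by rewrite le_min_sqdist; apply/allP => a _; rewrite lee_fin sqr_ge0. Qed.

Lemma measurable_min_sqdist (R : realType) (al : seq R) :
  measurable_fun [set: measurableTypeR R]
    (fun x : R => \big[mine/+oo]_(a <- al) ((x - a) ^+ 2)%:E)%E.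
Proof.
elim: al => [|a al IH].
  by under eq_fun do rewrite big_nil; exact: measurable_cst.
under eq_fun do rewrite big_cons.
apply: measurable_mine IH; apply/measurable_EFinP; exact: measurable_sqdist.
Qed.

Lemma fenced_le_distortion (R : realType) (P : probability (measurableTypeR R) R)
    (al : {fset R}) :
  (\int[P]_x (fenced_sqdist al x)%:E <= distortion P al)%E.
Proof.
apply: ge0_le_integral => //.
- by move=> x _; rewrite lee_fin fenced_sqdist_ge0.
- by apply/measurable_EFinP; exact: measurable_fenced_sqdist.
- exact: measurable_min_sqdist.
- move=> x _; rewrite le_min_sqdist.
  by have := lexx (fenced_sqdist al x); rewrite {1}le_fenced_sqdist => /and3P[].
Qed.

Lemma quantization_error_ge (R : realType) (P : probability (measurableTypeR R) R)
    (hP : triadic_cantor P) (k n : nat) :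
  ((25 ^- k * (10^-1 * (2 - n%:R / 3 ^+ k)))%:E <= quantization_error P n)%E.
Proof.
apply: le_ereal_inf_tmp => _ [al [_ len] <-].
apply: le_trans (fenced_le_distortion P al).
apply: le_trans (integral_fenced_ge hP k al).
rewrite lee_fin ler_pM2l ?invr_gt0 ?exprn_gt0 // ler_pM2l // lerD2l lerN2.
by rewrite ler_pM2r ?invr_gt0 ?exprn_gt0 // ler_nat (leq_trans _ len) // count_size.
Qed.

(** * Upper bound for the quantization error *)

(** If [be] contains the three copies of [al], every cell is served at least as
    well as [[0, 1]] is by [al], at a fifth of the scale. *)
Lemma distortion_refine (R : realType) (P : probability (measurableTypeR R) R)
    (hP : triadic_cantor P) (al be : {fset R}) (r : R) :
  (forall j a, (1 <= j < 4)%N -> a \in al -> triadicS j a \in be) ->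
  (distortion P al <= r%:E)%E -> (distortion P be <= (25^-1 * r)%:E)%E.
Proof.
move=> albe lr; rewrite /distortion integral_triadic //; last 2 first.
- exact: measurable_min_sqdist.
- by move=> x; exact: min_sqdist_ge0.
have cell j : (1 <= j < 4)%N ->
    (\int[P]_x \big[mine/+oo]_(a <- be) ((triadicS j x - a) ^+ 2)%:E <=
     (25^-1 * r)%:E)%E.
  move=> j14; apply: (@le_trans _ _ (25^-1%:E * distortion P al)%E); last first.
    by rewrite EFinM lee_pmul2l.
  rewrite -ge0_integralZl_EFin //; last 2 first.
  - by move=> x _; exact: min_sqdist_ge0.
  - exact: measurable_min_sqdist.
  apply: ge0_le_integral => //.
  - by move=> x _; exact: min_sqdist_ge0.
  - apply: (measurableT_comp (measurable_min_sqdist be)).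
    exact: measurable_triadicS.
  - by apply: measurable_funeM; exact: measurable_min_sqdist.
  - move=> x _; rewrite lee_pdivlMl // le_min_sqdist; apply/allP => a aal.
    rewrite -lee_pdivlMl // -EFinM.
    have := lexx (\big[mine/+oo]_(b <- be) ((triadicS j x - b) ^+ 2)%:E)%E.
    rewrite {1}le_min_sqdist => /allP/(_ _ (albe j a j14 aal)).
    have -> // : (triadicS j x - triadicS j a) ^+ 2 = 25^-1 * (x - a) ^+ 2.
    by rewrite /triadicS; field.
have -> : (25^-1 * r)%:E = (3^-1%:E * ((25^-1 * r)%:E + (25^-1 * r)%:E + (25^-1 * r)%:E))%E.
  by rewrite -!EFinD -EFinM; congr EFin; field.
rewrite lee_pmul2l // 3?big_nat_recl // big_geq // adde0 addeA.
by apply: leeD; [apply: leeD|]; exact: cell.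
Qed.

Lemma distortion_half (R : realType) (P : probability (measurableTypeR R) R)
    (hP : triadic_cantor P) : distortion P [fset 2^-1]%fset = (9^-1)%:E.
Proof.
have E x : (x - 2^-1) ^+ 2 = 1 * x ^+ 2 + (-1) * x + 4^-1 :> R by field.
rewrite /distortion; under eq_integral do rewrite big_seq_fset1.
rewrite integral_unit //.
- under eq_integral do rewrite E.
  by rewrite integral_quadratic //; congr EFin; field.
- by apply/measurable_EFinP; exact: measurable_sqdist.
- by move=> x; rewrite lee_fin sqr_ge0.
Qed.

Lemma quantization_error_le (R : realType) (P : probability (measurableTypeR R) R)
    (hP : triadic_cantor P) (k : nat) :
  (quantization_error P (3 ^ k) <= (25 ^- k * 9^-1)%:E)%E.
Proof.
suff [al [al0 lek ldist]] : exists al : {fset R},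
    [/\ (1 <= #|` al|)%N, (#|` al| <= 3 ^ k)%N &
     (distortion P al <= (25 ^- k * 9^-1)%:E)%E].
  by apply: le_trans ldist; apply: ereal_inf_lbound; exists al.
elim: k => [|k [al [al0 lek ldist]]].
  exists [fset 2^-1]%fset; rewrite cardfs1; split => //.
  by rewrite distortion_half // expr0 invr1 mul1r.
pose im j : {fset R} := [fset triadicS j a | a in al]%fset.
have le_im j : (#|` im j| <= #|` al|)%N by exact: leq_imfset_card.
have [a aal] : exists a, a \in al.
  by apply/fset0Pn; rewrite -cardfs_gt0.
have im_in j b : b \in al -> triadicS j b \in im j.
  by move=> bal; apply/imfsetP; exists b.
exists (im 1%N `|` im 2%N `|` im 3%N)%fset; split.
- rewrite cardfs_gt0; apply/fset0Pn; exists (triadicS 3 a).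
  by rewrite !in_fsetU im_in // orbT.
- rewrite expnS.
  have h1 := (leq_card_fsetU (im 1%N `|` im 2%N)%fset (im 3%N)).1.
  have h2 := (leq_card_fsetU (im 1%N) (im 2%N)).1.
  have := le_im 1%N; have := le_im 2%N; have := le_im 3%N.
  by lia.
- rewrite exprS invfM -mulrA; apply: distortion_refine ldist => // j b j14 bal.
  rewrite !in_fsetU; case: j j14 => [//|[|[|[|//]]]] _; by rewrite im_in ?orbT.
Qed.

(** * Incompatible subsequences *)

Lemma cvg_pow3 (m : nat) : (0 < m)%N -> (m * 3 ^ k)%N @[k --> \oo] --> \oo.
Proof.
move=> m0; apply/cvgnyPge => A; exists A => // k /= Ak.
rewrite (leq_trans Ak) // (leq_trans (ltnW (ltn_expl k (isT : 1 < 3)%N))) //.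
by rewrite leq_pmull.
Qed.

(** [3 `^ (2 / beta) = 25], as [ln 3 / beta = ln 5]. *)
Lemma natpow_cantor_dim (R : realType) (m k : nat) :
  (m * 3 ^ k)%:R `^ (2 / cantor_dim R) = m%:R `^ (2 / cantor_dim R) * 25 ^+ k.
Proof.
rewrite natrM powRM //; congr (_ * _).
rewrite /powR natrX expf_eq0 pnatr_eq0 andbF lnXn //.
have l3 : ln (3 : R) != 0 by rewrite gt_eqF // ln_gt0 // ltr1n.
have l5 : ln (5 : R) != 0 by rewrite gt_eqF // ln_gt0 // ltr1n.
rewrite -[RHS]lnK ?posrE ?exprn_gt0 // lnXn //; congr expR.
have -> : (25 : R) = 5 ^+ 2 by ring.
rewrite lnXn // -(mulr_natl (ln 3) k) -(mulr_natl (ln 5 *+ 2) k) -(mulr_natl (ln 5) 2).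
by rewrite /cantor_dim; field; apply/andP.
Qed.

Lemma cantor_dim_exponent_ge2 (R : realType) : 2 <= 2 / cantor_dim R.
Proof.
have l3 : 0 < ln (3 : R) by rewrite ln_gt0 // ltr1n.
have l5 : 0 < ln (5 : R) by rewrite ln_gt0 // ltr1n.
have l35 : ln (3 : R) <= ln 5 by rewrite ler_ln ?posrE // ler_nat.
by rewrite /cantor_dim ler_pdivlMr ?divr_gt0 // ler_piMr // ler_pdivrMr // mul1r.
Qed.

Theorem theorem4p2 (R : realType) (P : probability (measurableTypeR R) R)
    (hP : triadic_cantor P) :
  ~ quantization_coefficient_exists P (cantor_dim R).
Proof.
move=> /cvg_ex[l cl].
set e := 2 / cantor_dim R.
have c3 : quantization_seq P (cantor_dim R) (1 * 3 ^ k)%N @[k --> \oo] --> l.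
  exact: cvg_comp (cvg_pow3 _) cl.
have c4 : quantization_seq P (cantor_dim R) (4 * 3 ^ k)%N @[k --> \oo] --> l.
  exact: cvg_comp (cvg_pow3 _) cl.
have lu : (l <= (9^-1)%:E)%E.
  apply: cvge_le c3; apply: nearW => k.
  rewrite /quantization_seq natpow_cantor_dim powR1 mul1r mul1n.
  have := quantization_error_le hP k.
  rewrite -(@lee_pmul2l _ (25 ^+ k)%:E) // ?lte_fin ?exprn_gt0 //.
  by rewrite -EFinM mulrA divff ?mul1r // expf_neq0.
have ll : ((16 / 135)%:E <= l)%E.
  apply: cvge_ge c4; apply: nearW => k.
  rewrite /quantization_seq natpow_cantor_dim.
  have := quantization_error_ge hP k.+1 (4 * 3 ^ k).
  have p4 : 400 / 9 <= 4 `^ e.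
    have -> : (4 : R) `^ e = (4 / 3) `^ e * 25.
      have -> : 25 = 3 `^ e :> R.
        by have := @natpow_cantor_dim R 1 1; rewrite mul1n expn1 powR1 mul1r expr1.
      by rewrite -powRM //; congr (_ `^ _); field.
    have := @ler_powR R (4 / 3) _ 2 e (cantor_dim_exponent_ge2 R).
    rewrite powR_mulrn //; lra.
  have t0 : 0 < 4 `^ e * 25 ^+ k by rewrite mulr_gt0 ?powR_gt0 ?exprn_gt0.
  rewrite -(@lee_pmul2l _ (4 `^ e * 25 ^+ k)%:E) ?lte_fin //.
  apply: le_trans; rewrite -EFinM lee_fin.
  rewrite natrM natrX !exprS.
  rewrite [leRHS](_ : _ = 4 `^ e * (2 / 750)); last first.
    by field; rewrite !expf_neq0.
  lra.
have := le_trans ll lu; rewrite lee_fin; lra.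
Qed.
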